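(* Let $(L^k,g)$ and $(M^n,h)$ be oriented Riemannian manifolds with $k\le n$, let $u\colon L\to M$ be a smooth map, and let $\alpha\in\Omega^k(M)$ be a calibration (not necessarily closed). Put $\lambda=\frac{1}{\sqrt{k}}|du|$. Then $$u^*\alpha\le \lambda^k\,\mathrm{vol}_L$$ at every point of $L$. Moreover, equality holds (at all points of $L$) if and only if both of the following hold: (1) $u^*h=\lambda^2 g$ on $L$ (that is, $u$ is weakly conformal); (2) the image $u(L^0)$ is calibrated with respect to $\alpha$, where $L^0=\{x\in L: du_x\ne 0\}$.
   Context: Manifolds are smooth and oriented, not necessarily compact. A form $\alpha\in\Omega^k(M)$ on $(M,h)$ is a calibration if $\alpha(e_1,\dots,e_k)\le 1$ for all orthonormal $e_1,\dots,e_k\in T_xM$ and all $x\in M$ (comass at most one; closedness is not assumed). An oriented $k$-plane in $T_yM$ is $\alpha$-calibrated if $\alpha(e_1,\dots,e_k)=1$ for an oriented orthonormal basis $e_1,\dots,e_k$. When $u^*h=\lambda^2g$, the restriction of $u$ to $L^0$ is an immersion, and ''$u(L^0)$ is calibrated with respect to $\alpha$'' means that for each $x\in L^0$ the $k$-plane $du_x(T_xL)$, with the orientation induced from $T_xL$ by $du_x$, is $\alpha$-calibrated. $|du|^2=\operatorname{tr}_g(u^*h)=\sum_i h(du(e_i),du(e_i))$ for a $g$-orthonormal frame $(e_i)$. Inequalities between $k$-forms on $L$ are inequalities of their coefficients with respect to the Riemannian volume form $\mathrm{vol}_L$. *)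

(* Defs.v *)
From HB Require Import structures.
From mathcomp Require Import all_boot all_order all_algebra.
From mathcomp Require Import all_classical all_reals all_analysis.

Set Implicit Arguments.
Unset Strict Implicit.
Unset Printing Implicit Defensive.

Import Order.TTheory GRing.Theory Num.Theory numFieldNormedType.Exports.

Local Open Scope classical_set_scope.
Local Open Scope ring_scope.

(* f is of class C^r at every point of U; meaningful for U open, since
   'd f x only depends on the germ of f at x. *)
Fixpoint Cr_on (R : realType) (V W : normedModType R) (r : nat) (U : set V)
    (f : V -> W) : Prop :=
  if r is r'.+1 then
    (forall x, U x -> differentiable f x) /\
    (forall v, Cr_on r' U (fun x => 'd f x v))
  else forall x, U x -> {for x, continuous f}.

Definition smooth_on (R : realType) (V W : normedModType R) (U : set V)
  (f : V -> W) : Prop := forall r, Cr_on r U f.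

(* A homeomorphism from the open set cdom onto the open set ccod; the values of
   cmap outside cdom and of cinv outside ccod are irrelevant. *)
Record chart (R : realType) (T : topologicalType) (n : nat) := Chart {
  cdom : set T;
  ccod : set 'rV[R]_n;
  cmap : T -> 'rV[R]_n;
  cinv : 'rV[R]_n -> T;
  cdom_open : open cdom;
  ccod_open : open ccod;
  cmap_cod : forall x, cdom x -> ccod (cmap x);
  cinv_dom : forall y, ccod y -> cdom (cinv y);
  cmapK : forall x, cdom x -> cinv (cmap x) = x;
  cinvK : forall y, ccod y -> cmap (cinv y) = y;
  cmap_continuous : {within cdom, continuous cmap};
  cinv_continuous : {within ccod, continuous cinv} }.

(* A smooth oriented n-manifold without boundary. The orientation is given by
   an oriented atlas, which is the general notion for n > 0. The field chart_at
   selects a chart around each point; it only serves to give a concrete model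
   of the tangent spaces. *)
Record omanifold (R : realType) (n : nat) := OManifold {
  carrier :> topologicalType;
  carrier_hausdorff : hausdorff_space carrier;
  carrier_second_countable : @second_countable carrier;
  atlas : set (chart R carrier n);
  chart_at : carrier -> chart R carrier n;
  chart_at_atlas : forall x, atlas (chart_at x);
  chart_at_dom : forall x, cdom (chart_at x) x;
  transition_smooth : forall c d, atlas c -> atlas d ->
    smooth_on [set y | ccod c y /\ cdom d (cinv c y)] (cmap d \o cinv c);
  transition_oriented : forall c d, atlas c -> atlas d ->
    forall y, ccod c y -> cdom d (cinv c y) ->
    0 < \det ('J (cmap d \o cinv c) y) }.

(* T_xM, identified with R^n by the differential at x of the chart chart_at x.
   Every tensor field and every differential below is expressed through this
   identification. *)
Definition tangent (R : realType) (n : nat) (M : omanifold R n) (x : M) :=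
  'rV[R]_n.

(* The tangent vector at the point of coordinates y in the chart c whose
   components in the chart c are v. *)
Definition chart_vector (R : realType) (n : nat) (M : omanifold R n)
    (c : chart R M n) (y v : 'rV[R]_n) : tangent (cinv c y) :=
  'd (cmap (chart_at (cinv c y)) \o cinv c) y v.

Record metric (R : realType) (n : nat) (M : omanifold R n) := Metric {
  inner :> forall x : M, {dot (tangent x) for idfun};
  inner_smooth : forall c, atlas c -> forall v w : 'rV[R]_n,
    smooth_on (W := R^o) (ccod c)
      (fun y => inner (cinv c y) (chart_vector c y v) (chart_vector c y w)) }.

Definition multilinear_form (R : realType) (V : lmodType R) (k : nat)
  (w : ('I_k -> V) -> R) : Prop :=
  forall (e : 'I_k -> V) (i : 'I_k), scalar (fun v => w [eta e with i |-> v]).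

Definition alternating_form (R : realType) (V : lmodType R) (k : nat)
  (w : ('I_k -> V) -> R) : Prop :=
  forall (e : 'I_k -> V) (i j : 'I_k), i != j -> e i = e j -> w e = 0.

Record dform (R : realType) (n : nat) (M : omanifold R n) (k : nat) := DForm {
  dform_val :> forall x : M, ('I_k -> tangent x) -> R;
  dform_multilinear : forall x : M, multilinear_form (dform_val (x := x));
  dform_alternating : forall x : M, alternating_form (dform_val (x := x));
  dform_smooth : forall c, atlas c -> forall v : 'I_k -> 'rV[R]_n,
    smooth_on (W := R^o) (ccod c)
      (fun y => dform_val (fun i => chart_vector c y (v i))) }.

Section RiemannianPoint.
Variables (R : realType) (n : nat) (M : omanifold R n) (h : metric M) (x : M).

Definition orthonormal_frame (k : nat) (e : 'I_k -> tangent x) : Prop :=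
  forall i j, h x (e i) (e j) = (i == j)%:R.

Definition frame_mx (k : nat) (e : 'I_k -> tangent x) : 'M[R]_(k, n) :=
  \matrix_(i < k) e i.

(* The chart chart_at x belongs to the oriented atlas. *)
Definition oriented_basis (e : 'I_n -> tangent x) : Prop :=
  0 < \det (frame_mx e).

Definition gram (b : tangent x -> tangent x -> R) : 'M[R]_n :=
  \matrix_(i, j) b (delta_mx 0 i) (delta_mx 0 j).

(* sum_ij h^ij b_ij *)
Definition metric_trace (b : tangent x -> tangent x -> R) : R :=
  \tr (invmx (gram (h x)) *m gram b).

(* sqrt(det h_ij) dx^1 /\ ... /\ dx^n in the oriented chart chart_at x *)
Definition vol (e : 'I_n -> tangent x) : R :=
  Num.sqrt (\det (gram (h x))) * \det (frame_mx e).

(* Comparison of n-covectors by their coefficients with respect to vol. *)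
Definition covector_le (w1 w2 : ('I_n -> tangent x) -> R) : Prop :=
  exists a b : R, [/\ forall e, w1 e = a * vol e,
                      forall e, w2 e = b * vol e & a <= b].

End RiemannianPoint.

Arguments orthonormal_frame {R n M} h x {k} e.
Arguments oriented_basis {R n M} x e.
Arguments gram {R n M} x b.
Arguments metric_trace {R n M} h x b.
Arguments vol {R n M} h x e.
Arguments covector_le {R n M} h x w1 w2.

Definition calibration (R : realType) (n : nat) (M : omanifold R n)
  (h : metric M) (k : nat) (alpha : dform M k) : Prop :=
  forall (x : M) (e : 'I_k -> tangent x),
    orthonormal_frame h x e -> alpha x e <= 1.

(* An oriented k-plane is represented by the set B of its oriented bases. *)
Definition calibrated_plane (R : realType) (n : nat) (M : omanifold R n)
  (h : metric M) (k : nat) (alpha : dform M k) (y : M)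
  (B : set ('I_k -> tangent y)) : Prop :=
  exists e, [/\ B e, orthonormal_frame h y e & alpha y e = 1].

Section Maps.
Variables (R : realType) (k n : nat) (L : omanifold R k) (M : omanifold R n).

Definition smooth_map (u : L -> M) : Prop :=
  continuous u /\
  forall c d, atlas c -> atlas d ->
    smooth_on [set y | ccod c y /\ cdom d (u (cinv c y))]
      (cmap d \o u \o cinv c).

Definition differential (u : L -> M) (x : L) (v : tangent x) : tangent (u x) :=
  'd (cmap (chart_at (u x)) \o u \o cinv (chart_at x)) (cmap (chart_at x) x) v.

Arguments differential u x v : clear implicits.

Definition pullback_form (u : L -> M) (m : nat) (alpha : dform M m) (x : L)
  (e : 'I_m -> tangent x) : R :=
  alpha (u x) (fun i => differential u x (e i)).

Definition pullback_metric (u : L -> M) (h : metric M) (x : L)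
  (v w : tangent x) : R :=
  h (u x) (differential u x v) (differential u x w).

Arguments pullback_metric u h x v w : clear implicits.

Definition diff_norm (g : metric L) (h : metric M) (u : L -> M) (x : L) : R :=
  Num.sqrt (metric_trace g x (pullback_metric u h x)).

(* The oriented bases of du_x(T_xL), with the orientation induced from T_xL by
   du_x, when du_x is injective. *)
Definition image_oriented_bases (u : L -> M) (x : L) :
  set ('I_k -> tangent (u x)) :=
  [set e | exists2 f : 'I_k -> tangent x,
             oriented_basis x f & e = (fun i => differential u x (f i))].

Definition diff_nonzero_locus (u : L -> M) : set L :=
  [set x | exists v : tangent x, differential u x v <> 0].

End Maps.

Arguments smooth_map {R k n L M} u.
Arguments differential {R k n L M} u x v.
Arguments pullback_form {R k n L M} u {m} alpha x e.
Arguments pullback_metric {R k n L M} u h x v w.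
Arguments diff_norm {R k n L M} g h u x.
Arguments image_oriented_bases {R k n L M} u x.
Arguments diff_nonzero_locus {R k n L M} u.

Section Frames.
Variables (R : realType) (n : nat) (M : omanifold R n) (h : metric M) (x : M).

Lemma frame_gram (b : tangent x -> tangent x -> R) (k : nat)
    (e : 'I_k -> tangent x) :
  (forall v, scalar (b v)) -> (forall w, scalar (b^~ w)) ->
  frame_mx e *m gram x b *m (frame_mx e)^T = \matrix_(i, j) b (e i) (e j).
Proof.
move=> br bl.
have sumr v m (c : 'I_m -> R) (w : 'I_m -> tangent x) :
    b v (\sum_j c j *: w j) = \sum_j c j * b v (w j).
  pose B : {scalar 'rV[R]_n} := HB.pack (b v : 'rV[R]_n -> R)
    (GRing.isLinear.Build R 'rV[R]_n R *%R (b v) (br v)).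
  rewrite -[LHS]/(B _) linear_sum; apply: eq_bigr => j _.
  by rewrite linearZ.
have suml w m (c : 'I_m -> R) (v : 'I_m -> tangent x) :
    b (\sum_j c j *: v j) w = \sum_j c j * b (v j) w.
  pose B : {scalar 'rV[R]_n} := HB.pack (b^~ w : 'rV[R]_n -> R)
    (GRing.isLinear.Build R 'rV[R]_n R *%R (b^~ w) (bl w)).
  rewrite -[LHS]/(B _) linear_sum; apply: eq_bigr => j _.
  by rewrite linearZ.
apply/matrixP => i j; rewrite !mxE [e i]row_sum_delta [e j]row_sum_delta sumr.
apply: eq_bigr => l _; rewrite suml !mxE mulrC; congr (_ * _).
by apply: eq_bigr => m _; rewrite !mxE.
Qed.

Lemma orthonormal_gram (e : 'I_n -> tangent x) : orthonormal_frame h x e ->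
  frame_mx e *m gram x (h x) *m (frame_mx e)^T = 1%:M.
Proof.
move=> eo; rewrite frame_gram.
- by apply/matrixP => i j; rewrite !mxE eo.
- by move=> v a p q; rewrite linearPr.
- by move=> w a p q; rewrite linearPl.
Qed.

Lemma metric_trace_frame (b : tangent x -> tangent x -> R)
    (e : 'I_n -> tangent x) :
  (forall v, scalar (b v)) -> (forall w, scalar (b^~ w)) ->
  orthonormal_frame h x e -> metric_trace h x b = \sum_i b (e i) (e i).
Proof.
move=> br bl eo; have E := orthonormal_gram eo.
have Eu : (frame_mx e)^T \in unitmx by case: (mulmx1_unit E).
have E' : (frame_mx e)^T *m frame_mx e *m gram x (h x) = 1%:M.
  by rewrite -mulmxA; apply: mulmx1C.
have -> : metric_trace h x b = \tr ((frame_mx e)^T *m frame_mx e *m gram x b).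
  rewrite /metric_trace; congr (\tr (_ *m _)).
  have [_ gu] := mulmx1_unit E'.
  by rewrite -[LHS]mul1mx -E' mulmxK.
rewrite -mulmxA mxtrace_mulC frame_gram //.
by apply: eq_bigr => i _; rewrite mxE.
Qed.

Lemma vol_frame (e : 'I_n -> tangent x) :
  orthonormal_frame h x e -> oriented_basis x e -> vol h x e = 1.
Proof.
move=> eo ep; have := congr1 determinant (orthonormal_gram eo).
rewrite !det_mulmx det_tr det1 mulrAC -expr2 => E.
rewrite /vol; have d0 : \det (frame_mx e) != 0 by rewrite gt_eqF.
have -> : \det (gram x (h x)) = (\det (frame_mx e))^-1 ^+ 2.
  by apply: (mulfI (expf_neq0 2 d0)); rewrite E -exprMn divff // expr1n.
by rewrite sqrtr_sqr ger0_norm ?invr_ge0 ?ltW// mulVf.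
Qed.

End Frames.

Lemma diff_norm_frame (R : realType) (k n : nat) (L : omanifold R k)
    (M : omanifold R n) (g : metric L) (h : metric M) (u : L -> M) (x : L)
    (e : 'I_k -> tangent x) : orthonormal_frame g x e ->
  diff_norm g h u x =
  Num.sqrt (\sum_i h (u x) (differential u x (e i)) (differential u x (e i))).
Proof.
move=> eo; rewrite /diff_norm (metric_trace_frame _ _ eo) //.
- by move=> v a p q; rewrite /pullback_metric /differential linearP linearPr.
- by move=> w a p q; rewrite /pullback_metric /differential linearP linearPl.
Qed.

(* Main.v *)
Require Import Defs.
From HB Require Import structures.
From mathcomp Require Import all_boot all_order all_algebra all_fingroup.
From mathcomp Require Import all_classical all_reals all_analysis.

Set Implicit Arguments.
Unset Strict Implicit.
Unset Printing Implicit Defensive.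

Import Order.TTheory GRing.Theory Num.Theory numFieldNormedType.Exports.

Local Open Scope classical_set_scope.
Local Open Scope ring_scope.

(* The claim is pointwise linear algebra in a g-orthonormal oriented frame (e_i)
   of T_xL. Put v_i = du(e_i). Gram-Schmidt replaces (v_i) by an orthogonal
   family without changing alpha(v_1, ..., v_k) and without increasing any norm,
   so comass at most one gives alpha(v_1, ..., v_k) <= prod_i |v_i|, and AM-GM
   for the |v_i|^2 bounds the product by lambda^k. Equality in AM-GM makes all
   |v_i| equal to lambda, and equality in the first bound makes the v_i
   orthogonal, so u is conformal at x and (v_i / lambda) is a calibrated
   orthonormal frame. Since top-degree forms are multiples of vol, values on a
   single oriented orthonormal frame decide everything. *)

(** * Scaling, shears and transpositions in multilinear alternating forms *)

Section MultilinearForms.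
Variables (R : realType) (V : lmodType R) (k : nat) (w : ('I_k -> V) -> R).
Hypothesis w_mlin : multilinear_form w.
Implicit Types (e : 'I_k -> V) (i j : 'I_k).

Lemma fun_with_id e i : [eta e with i |-> e i] = e :> ('I_k -> V).
Proof. by apply/funext => l /=; case: eqP => // ->. Qed.

Lemma multilinear_sum e i m (c : 'I_m -> R) (p : 'I_m -> V) :
  w [eta e with i |-> \sum_j c j *: p j] =
  \sum_j c j * w [eta e with i |-> p j].
Proof.
pose F v := w [eta e with i |-> v].
pose B : {scalar V} :=
  HB.pack F (GRing.isLinear.Build R V R *%R F (w_mlin e i)).
by rewrite -[LHS]/(B _) linear_sum; apply: eq_bigr => j _; rewrite linearZ.
Qed.

Lemma multilinearD e i p q :
  w [eta e with i |-> p + q] =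
  w [eta e with i |-> p] + w [eta e with i |-> q].
Proof. by have := w_mlin e i 1 p q; rewrite scale1r mul1r. Qed.

Lemma multilinear_at0 e i : e i = 0 -> w e = 0.
Proof.
move=> ei0; have := multilinearD e i 0 0.
rewrite addr0 -{1 2 3}ei0 fun_with_id => /eqP.
by rewrite -subr_eq0 opprD addNKr oppr_eq0 => /eqP.
Qed.

Lemma multilinearZ_at e i a : w [eta e with i |-> a *: e i] = a * w e.
Proof.
have := w_mlin e i a (e i) 0; rewrite addr0 fun_with_id => ->.
by rewrite [X in _ + X](@multilinear_at0 _ i) ?addr0//= eqxx.
Qed.

Lemma multilinearZ e (c : 'I_k -> R) :
  w (fun i => c i *: e i) = (\prod_i c i) * w e.
Proof.
(* [r] lists the slots already rescaled; the induction rescales one further slot at a time. *)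
pose f (r : seq 'I_k) i := if i \in r then c i *: e i else e i.
suff E r : uniq r -> w (f r) = (\prod_(i <- r) c i) * w e.
  rewrite -[index_enum _]enumT -E ?enum_uniq//; congr w.
  by apply/funext => i; rewrite /f mem_enum.
elim: r => [_|i r IH /= /andP[ir ur]]; first by rewrite big_nil mul1r.
rewrite big_cons -mulrA -(IH ur) -(multilinearZ_at _ i); congr w.
apply/funext => l /=; rewrite /f inE (negPf ir).
by case: (eqVneq l i) => [->|].
Qed.

Hypothesis w_alt : alternating_form w.

(** Expanding slot [i] by linearity, each correction term with [j] different from [i] repeats the
    argument [e j], and the term [j = i] has coefficient zero. This drives both Gram-Schmidt and the
    equality case. *)
Lemma alternating_shear e i (c : 'I_k -> R) : c i = 0 ->
  w [eta e with i |-> e i - \sum_j c j *: e j] = w e.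
Proof.
move=> ci0; rewrite multilinearD fun_with_id -sumrN.
under eq_bigr do rewrite -scaleNr.
rewrite multilinear_sum big1 ?addr0// => j _.
have [->|ji] := eqVneq j i; first by rewrite ci0 oppr0 mul0r.
rewrite (w_alt (i := i) (j := j)) ?mulr0 // 1?eq_sym //=.
by rewrite eqxx (negPf ji).
Qed.

(** Polarization: with [e i + e j] in both slots the form vanishes, and only the two mixed terms
    survive the expansion. *)
Lemma alternating_tperm e i j : i != j -> w (e \o tperm i j) = - w e.
Proof.
move=> ij; pose F p q := w [eta [eta e with i |-> p] with j |-> q].
have FE p q : F p q = w [eta [eta e with j |-> q] with i |-> p].
  congr w; apply/funext => l /=; case: (eqVneq l j) => // ->.
  by rewrite eq_sym (negPf ij).
have F0 p : F p p = 0.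
  by apply: (w_alt ij) => /=; rewrite eqxx (negPf ij) eqxx.
have FDr p q r : F p (q + r) = F p q + F p r by exact: multilinearD.
have FDl p q r : F (p + q) r = F p r + F q r.
  by rewrite !FE multilinearD.
have Fij : F (e i) (e j) = w e.
  by congr w; apply/funext => l /=; case: eqP => [->//|_]; case: eqP => // ->.
have Fji : F (e j) (e i) = w (e \o tperm i j).
  congr w; apply/funext => l /=; case: tpermP => [->|->|].
  - by rewrite eqxx (negPf ij).
  - by rewrite eqxx.
  - by move=> /eqP/negPf -> /eqP/negPf ->.
have := F0 (e i + e j); rewrite FDr !FDl !F0 add0r addr0 Fij Fji => /eqP.
by rewrite addr_eq0 => /eqP ->; rewrite ?opprK.
Qed.

End MultilinearForms.

(** * Top-degree alternating forms are multiples of the determinant *)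

Section TopForms.
Variable R : realType.

Lemma multilinear_eq0 (n k : nat) (w : ('I_k -> 'rV[R]_n) -> R) :
  multilinear_form w ->
  (forall phi : 'I_k -> 'I_n, w (fun i => delta_mx 0 (phi i)) = 0) ->
  forall e, w e = 0.
Proof.
(* Induction on a list [r] containing every slot not yet filled by a standard basis vector. *)
move=> wm w0; suff H (r : seq 'I_k) e :
    (forall i, i \notin r -> exists j, e i = delta_mx 0 j) -> w e = 0.
  by move=> e; apply: (H (enum 'I_k)) => i; rewrite mem_enum.
elim: r e => [|i r IH] e er.
  have /choice[phi ephi] : forall i, exists j, e i = delta_mx 0 j.
    by move=> i; exact: er.
  by rewrite (_ : e = fun i => delta_mx 0 (phi i)) ?w0//; exact/funext.
rewrite -(fun_with_id e i) [e i]row_sum_delta (multilinear_sum wm).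
rewrite big1// => j _.
rewrite IH ?mulr0// => l lr /=.
by case: (eqVneq l i) => [_|li]; [exists j|apply: er; rewrite inE negb_or li].
Qed.

(** By multilinearity only tuples of basis vectors matter. A non-injective choice repeats an
    argument; an injective one is a permutation, hence a product of transpositions, each of which
    only changes the sign. *)
Lemma alternating_top_eq0 (n : nat) (w : ('I_n -> 'rV[R]_n) -> R) :
  multilinear_form w -> alternating_form w ->
  w (fun i => delta_mx 0 i) = 0 -> forall e, w e = 0.
Proof.
move=> wm wa w0; apply: multilinear_eq0 => // phi.
case: (boolP (injectiveb phi)) => [/injectiveP phi_inj|]; last first.
  case/injectivePn => i [j ij eqij].
  by apply: (wa _ i j ij); rewrite eqij.
have -> : (fun i => delta_mx 0 (phi i)) =
    (fun i => delta_mx 0 i) \o perm phi_inj :> ('I_n -> 'rV[R]_n).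
  by apply/funext => i /=; rewrite permE.
case: (prod_tpermP (perm phi_inj)) => ts -> {phi phi_inj} dts.
elim: ts dts => [_|t ts IH /= /andP[dt dts]].
  by rewrite big_nil -[RHS]w0; congr w; apply/funext => i /=; rewrite perm1.
rewrite big_cons -[RHS]oppr0 -(IH dts) -(alternating_tperm wm wa _ dt).
by congr w; apply/funext => i /=; rewrite permM.
Qed.

Lemma det_multilinear (n : nat) :
  multilinear_form (fun e : 'I_n -> 'rV[R]_n => \det (\matrix_i e i)).
Proof.
move=> e i a p q.
rewrite -[X in _ = _ + X]mul1r; apply: (determinant_multilinear (i0 := i)).
- by rewrite !rowK /= eqxx scale1r.
- apply/matrixP => l m; rewrite !mxE /=.
  by rewrite eq_sym (negPf (neq_lift _ _)).
- apply/matrixP => l m; rewrite !mxE /=.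
  by rewrite eq_sym (negPf (neq_lift _ _)).
Qed.

Lemma det_alternating (n : nat) :
  alternating_form (fun e : 'I_n -> 'rV[R]_n => \det (\matrix_i e i)).
Proof.
move=> e i j ij eij; apply: (determinant_alternate ij) => l.
by rewrite !mxE eij.
Qed.

Lemma alternating_top_det (n : nat) (w : ('I_n -> 'rV[R]_n) -> R) :
  multilinear_form w -> alternating_form w ->
  forall e, w e = w (fun i => delta_mx 0 i) * \det (\matrix_i e i).
Proof.
move=> wm wa e; apply/eqP; rewrite -subr_eq0; apply/eqP.
pose f d := w d - w (fun i => delta_mx 0 i) * \det (\matrix_i (d i : 'rV[R]_n)).
apply: (@alternating_top_eq0 _ f).
- move=> d i a p q; rewrite /f wm det_multilinear.
  by rewrite [in RHS]mulrBr mulrDr opprD addrACA mulrCA.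
- move=> d i j ij dij.
  by rewrite /f (wa _ _ _ ij dij) (det_alternating ij dij) mulr0 subrr.
- rewrite /f (_ : \matrix_i _ = 1%:M) ?det1 ?mulr1 ?subrr//.
  by apply/matrixP => i j; rewrite !mxE eqxx /= eq_sym.
Qed.

End TopForms.

(** * Gram-Schmidt and a Hadamard inequality for forms of comass at most one *)

Section DotProducts.
Variables (R : realType) (V : lmodType R) (h : {dot V for idfun}).

Lemma dotC u v : h u v = h v u.
Proof. by rewrite (hermC h) /= expr0 mul1r. Qed.

Lemma dotZ a u v : h (a *: u) (a *: v) = a ^+ 2 * h u v.
Proof. by rewrite linearZl_LR linearZr_LR /= mulrA expr2. Qed.

Lemma dot_gt0 u : u != 0 -> 0 < h u u.
Proof. exact: neq0_dnorm_gt0. Qed.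

Lemma dot_ge0 u : 0 <= h u u.
Proof. by have [->|/dot_gt0/ltW//] := eqVneq u 0; rewrite linear0l. Qed.

Lemma dot_eq0 u : (h u u == 0) = (u == 0).
Proof.
apply/idP/idP => [|/eqP ->]; last by rewrite linear0l.
by apply: contraTT => /dot_gt0; rewrite lt0r => /andP[].
Qed.

(** At [v = 0] both sides are zero, so projection coefficients make sense for degenerate families
    too. *)
Lemma dot_proj u v : h u v / h v v * h v v = h u v.
Proof.
have [->|v0] := eqVneq v 0; first by rewrite !linear0r.
by rewrite divfK ?dot_eq0.
Qed.

(** The vectors are not normalized, so dependent families are allowed. Each step is a shear, which
    every alternating form ignores, and by Pythagoras a projection shortens the vector. *)
Lemma gram_schmidt (k : nat) (v : 'I_k -> V) : exists v' : 'I_k -> V,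
  [/\ forall i j, i != j -> h (v' i) (v' j) = 0,
      forall i, h (v' i) (v' i) <= h (v i) (v i) &
      forall w, multilinear_form w -> alternating_form w -> w v' = w v].
Proof.
suff H m : (m <= k)%N -> exists v' : 'I_k -> V,
    [/\ forall i j : 'I_k, (i < m)%N -> (j < i)%N -> h (v' i) (v' j) = 0,
      forall i, h (v' i) (v' i) <= h (v i) (v i) &
      forall w, multilinear_form w -> alternating_form w -> w v' = w v].
  have [v' [v'o v'n v'w]] := H k (leqnn k).
  exists v'; split=> // i j; rewrite neq_ltn => /orP[ij|ji].
    by rewrite dotC v'o.
  by rewrite v'o.
elim: m => [_|m IH mk]; first by exists v; split.
have {IH}[v' [v'o v'n v'w]] := IH (ltnW mk).
pose im := Ordinal mk.
(* The coefficients vanish from index [m] on; in particular [c im = 0], as the shear lemma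
   requires. *)
pose c (j : 'I_k) :=
  if (j < m)%N then h (v' im) (v' j) / h (v' j) (v' j) else 0.
pose S := \sum_j c j *: v' j.
pose p := v' im - S.
have hp (j : 'I_k) : (j < m)%N -> h p (v' j) = 0.
  move=> jm; rewrite linearBl linear_sumlz (bigD1 j) //= big1 => [|l lj].
    by rewrite addr0 linearZl_LR /c jm dot_proj subrr.
  rewrite linearZl_LR /c /=; case: ifP => [lm|_]; last by rewrite mul0r.
  have -> : h (v' l) (v' j) = 0; last by rewrite mulr0.
  move: lj; rewrite neq_ltn => /orP[lj|jl]; last by rewrite v'o.
  by rewrite dotC v'o.
(* The orthogonality behind Pythagoras for [v' im = p + S]. *)
have hpS : h p S = 0.
  rewrite linear_sumr big1 // => j _; rewrite linearZr_LR /c /=.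
  by case: ifP => [jm|_]; rewrite ?mul0r// hp// mulr0.
exists [eta v' with im |-> p]; split.
- move=> i j /=; rewrite ltnS => im' ji.
  have jm := leq_trans ji im'.
  have -> : (j == im) = false by apply: ltn_eqF.
  have [_|iim] := eqVneq i im; first exact: hp.
  by apply: v'o => //; rewrite ltn_neqAle im' andbT.
- move=> i /=; have [->|//] := eqVneq i im.
  apply: le_trans (v'n im); rewrite -[v' im](subrK S) -/p (hnormDd hpS).
  by rewrite lerDl dot_ge0.
- move=> w wm wa; rewrite -(v'w w wm wa) /p; apply: (alternating_shear wm wa).
  by rewrite /c ltnn.
Qed.

Lemma orthonormalize (k : nat) (v : 'I_k -> V) :
  (forall i j, i != j -> h (v i) (v j) = 0) -> (forall i, v i != 0) ->
  let e i := (Num.sqrt (h (v i) (v i)))^-1 *: v i in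
  forall i j, h (e i) (e j) = (i == j)%:R.
Proof.
move=> vo v0 e i j; have [<-|ij] := eqVneq i j.
  rewrite dotZ exprVn sqr_sqrtr ?dot_ge0// mulVf// dot_eq0; exact: v0.
by rewrite linearZl_LR linearZr_LR /= (vo _ _ ij) !mulr0.
Qed.

Section Hadamard.
Variables (k : nat) (w : ('I_k -> V) -> R).
Hypotheses (w_mlin : multilinear_form w) (w_alt : alternating_form w).
Hypothesis comass_le1 : forall e : 'I_k -> V,
  (forall i j, h (e i) (e j) = (i == j)%:R) -> w e <= 1.

(** After Gram-Schmidt the vectors are orthogonal and no longer than before. If none vanishes,
    extracting their norms leaves an orthonormal family, to which the comass bound applies;
    otherwise the form is zero. *)
Lemma hadamard v : w v <= \prod_i Num.sqrt (h (v i) (v i)).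
Proof.
have [v' [v'o v'n <-//]] := gram_schmidt v.
apply: (@le_trans _ _ (\prod_i Num.sqrt (h (v' i) (v' i)))); last first.
  by apply: ler_prod => i _; rewrite sqrtr_ge0 ler_wsqrtr.
have [i /eqP vi0|v'0] := pickP (fun i => v' i == 0).
  rewrite (multilinear_at0 w_mlin vi0).
  by apply: prodr_ge0 => *; exact: sqrtr_ge0.
pose s i := Num.sqrt (h (v' i) (v' i)).
have s0 i : 0 < s i by rewrite sqrtr_gt0 dot_gt0 ?v'0.
have -> : v' = fun i => s i *: ((s i)^-1 *: v' i).
  by apply/funext => i; rewrite scalerA divff ?scale1r// gt_eqF.
rewrite (multilinearZ w_mlin) -[leRHS]mulr1.
under [X in _ <= X * _]eq_bigr do
  rewrite scalerA divff ?gt_eqF// scale1r -/(s _).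
rewrite ler_pM2l; last by apply: prodr_gt0.
by apply: comass_le1; apply: orthonormalize => // i; rewrite v'0.
Qed.

(* Subtracting from [v j] its projection on [v i] leaves [w v] unchanged, so in
   the equality case it cannot decrease the bound. *)
Lemma hadamard_eq v :
  w v = \prod_i Num.sqrt (h (v i) (v i)) -> (forall i, v i != 0) ->
  forall i j, i != j -> h (v i) (v j) = 0.
Proof.
move=> wv v0 i j ij; pose a := h (v j) (v i) / h (v i) (v i).
pose c l := if l == i then a else 0.
have S_E : \sum_l c l *: v l = a *: v i.
  rewrite (bigD1 i)//= big1 ?addr0 /c ?eqxx// => l /negPf->.
  by rewrite scale0r.
have cj : c j = 0 by rewrite /c eq_sym (negPf ij).
pose p := v j - a *: v i.
have := hadamard [eta v with j |-> p].
rewrite /p -S_E (alternating_shear w_mlin w_alt) // S_E -/p wv.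
rewrite (bigD1 j)//= [leRHS](bigD1 j)//= eqxx.
under [X in _ <= _ * X]eq_bigr => l /negPf lj do rewrite lj.
rewrite ler_pM2r; last by apply: prodr_gt0 => l _; rewrite sqrtr_gt0 dot_gt0.
rewrite ler_sqrt ?dot_ge0// => le_p.
have hp : h p (a *: v i) = 0.
  have -> : h p (a *: v i) = a * h p (v i) by rewrite linearZr_LR.
  suff -> : h p (v i) = 0 by rewrite mulr0.
  by rewrite linearBl linearZl_LR /= dot_proj subrr.
(* Pythagoras for [v j = p + a *: v i] turns [le_p] into [a *: v i] having squared norm at most
   zero, so [a = 0]. *)
move: le_p; rewrite -{1 2}[v j](subrK (a *: v i)) -/p (hnormDd hp) gerDl.
rewrite linearZl_LR linearZr_LR /= => le0.
have : a * (a * h (v i) (v i)) == 0.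
  rewrite eq_le le0 /= mulrA mulr_ge0 ?dot_ge0// -expr2.
  exact: sqr_ge0.
rewrite !mulf_eq0 dot_eq0 (negPf (v0 i)) orbF orbb invr_eq0 dot_eq0.
by rewrite (negPf (v0 i)) orbF dotC => /eqP.
Qed.

End Hadamard.

End DotProducts.

(** * The pointwise bound by AM-GM and its equality case *)

Section CalibrationBound.
Variables (R : realType) (V : lmodType R) (h : {dot V for idfun}).
Variables (k : nat) (w : ('I_k -> V) -> R).
Hypotheses (w_mlin : multilinear_form w) (w_alt : alternating_form w).
Hypothesis comass_le1 : forall e : 'I_k -> V,
  (forall i j, h (e i) (e j) = (i == j)%:R) -> w e <= 1.
Variable v : 'I_k -> V.

(** For [v] the image under du of an orthonormal frame, this is the conformal factor of the theorem;
    its square is the mean of the squared norms. *)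
Let lambda := (Num.sqrt k%:R)^-1 * Num.sqrt (\sum_i h (v i) (v i)).

Let lambda_ge0 : 0 <= lambda.
Proof. by rewrite mulr_ge0 ?invr_ge0 ?sqrtr_ge0. Qed.

Let sqr_lambda : lambda ^+ 2 = (\sum_i h (v i) (v i)) / k%:R.
Proof.
rewrite exprMn exprVn !sqr_sqrtr ?ler0n 1?mulrC//.
by apply: sumr_ge0 => i _; exact: dot_ge0.
Qed.

(** AM-GM for the squared norms compares the squares of both sides; both sides being nonnegative,
    the inequality and its equality case pass to square roots. *)
Let prod_norm_AGM : \prod_i Num.sqrt (h (v i) (v i)) <= lambda ^+ k
  ?= iff [forall i, forall j, h (v i) (v i) == h (v j) (v j)].
Proof.
have p0 : 0 <= \prod_i Num.sqrt (h (v i) (v i)).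
  by apply: prodr_ge0 => *; exact: sqrtr_ge0.
have [] := @leif_AGM R 'I_k predT (fun i => h (v i) (v i)).
  by move=> i _; exact: dot_ge0.
rewrite card_ord -sqr_lambda.
have -> : \prod_i h (v i) (v i) = (\prod_i Num.sqrt (h (v i) (v i))) ^+ 2.
  by rewrite -prodrXl; apply: eq_bigr => i _; rewrite sqr_sqrtr ?dot_ge0.
by rewrite exprAC ler_sqr ?nnegrE ?exprn_ge0// eqrXn2 ?exprn_ge0.
Qed.

Lemma comass_bound : w v <= lambda ^+ k.
Proof. exact: le_trans (hadamard w_mlin w_alt comass_le1 v) prod_norm_AGM. Qed.

Lemma comass_bound_eq : (0 < k)%N -> w v = lambda ^+ k ->
  forall i j, h (v i) (v j) = lambda ^+ 2 * (i == j)%:R.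
Proof.
move=> k0 wv.
have le1 := hadamard w_mlin w_alt comass_le1 v.
(* The product of norms lies between [w v] and [lambda ^+ k], so equality of the ends forces
   equality in both bounds. *)
have eq_AGM : \prod_i Num.sqrt (h (v i) (v i)) = lambda ^+ k.
  by apply: le_anti; rewrite -{2}wv le1 prod_norm_AGM.
have /forallP eqN :
    [forall i, forall j, h (v i) (v i) == h (v j) (v j)].
  by rewrite -(prod_norm_AGM.2) eq_AGM.
have norm_v i : h (v i) (v i) = lambda ^+ 2.
  rewrite sqr_lambda (eq_bigr (fun=> h (v i) (v i))) => [|j _].
    by rewrite sumr_const card_ord -(mulr_natr (h _ _)) mulfK// pnatr_eq0 -lt0n.
  by apply/eqP; exact: (forallP (eqN j)).
move=> i j; have [<-|ij] := eqVneq i j; first by rewrite mulr1 norm_v.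
(* All norms equal [lambda], so a single zero vector forces the whole family to vanish. *)
have [l /eqP vl0|v0] := pickP (fun l => v l == 0).
  have l0 : lambda ^+ 2 = 0 by rewrite -(norm_v l) vl0 linear0l.
  rewrite l0 mul0r; have := norm_v i; rewrite l0 => /eqP.
  by rewrite dot_eq0 => /eqP->; rewrite linear0l.
rewrite mulr0; apply: (hadamard_eq w_mlin w_alt comass_le1) => //.
  by rewrite eq_AGM.
by move=> l; rewrite v0.
Qed.

End CalibrationBound.

(** * Oriented orthonormal frames and evaluation of tensors on them *)

Section Frames.
Variables (R : realType) (n : nat) (M : omanifold R n) (g : metric M) (x : M).

(** The determinant is itself an alternating form, so Gram-Schmidt on the standard basis keeps it
    equal to 1. Hence no vector vanishes, and dividing by the norms preserves its sign. *)
Lemma oriented_orthonormal_exists :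
  exists2 e : 'I_n -> tangent x, orthonormal_frame g x e & oriented_basis x e.
Proof.
have [v [vo _ vw]] := gram_schmidt (g x) (fun i => delta_mx 0 i).
have det_v : \det (\matrix_i v i) = 1.
  have E := vw _ (@det_multilinear R n) (@det_alternating R n).
  rewrite E -[RHS](det1 R n).
  by congr determinant; apply/matrixP => i j; rewrite !mxE eqxx /= eq_sym.
have v0 i : v i != 0.
  apply/eqP => /(multilinear_at0 (@det_multilinear R n)).
  by rewrite det_v; exact/eqP/oner_neq0.
pose s i := Num.sqrt (g x (v i) (v i)).
have s0 i : 0 < s i by rewrite sqrtr_gt0 dot_gt0.
exists (fun i => (s i)^-1 *: v i).
  exact: orthonormalize.
rewrite /oriented_basis /frame_mx (multilinearZ (@det_multilinear R n)).
rewrite det_v mulr1; apply: prodr_gt0 => i _.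
by rewrite invr_gt0.
Qed.

(** Both [w] and [vol] are multiples of the determinant, and [vol] is 1 on [e0], which fixes the
    ratio. *)
Lemma top_form_vol (w : ('I_n -> tangent x) -> R) (e0 : 'I_n -> tangent x) :
  multilinear_form w -> alternating_form w ->
  orthonormal_frame g x e0 -> oriented_basis x e0 ->
  forall e, w e = w e0 * vol g x e.
Proof.
move=> wm wa e0o e0p e; have := vol_frame e0o e0p; rewrite /vol => E.
rewrite (alternating_top_det wm wa e) (alternating_top_det wm wa e0).
rewrite -!/(frame_mx _) -mulrA; congr (_ * _).
by rewrite mulrA [X in X * _]mulrC E mul1r.
Qed.

Lemma oriented_basisZ (c : R) (e : 'I_n -> tangent x) :
  0 < c -> oriented_basis x e -> oriented_basis x (fun i => c *: e i).
Proof.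
move=> c0 ep; rewrite /oriented_basis /frame_mx.
rewrite (multilinearZ (@det_multilinear R n)) mulr_gt0//.
by rewrite prodr_gt0.
Qed.

Lemma bilinear_frame_eq (b : tangent x -> tangent x -> R) (c : R)
    (e : 'I_n -> tangent x) :
  (forall v, scalar (b v)) -> (forall w, scalar (b^~ w)) ->
  orthonormal_frame g x e ->
  (forall i j, b (e i) (e j) = c * (i == j)%:R) ->
  forall v w, b v w = c * g x v w.
Proof.
move=> br bl eo be v w; pose d p q : R := b p q - c * g x p q.
have dr p : scalar (d p).
  by move=> a y z; rewrite /d br linearPr /= mulrDr opprD addrACA mulrBr mulrCA.
have dl q : scalar (d^~ q).
  by move=> a y z; rewrite /d bl linearPl /= mulrDr opprD addrACA mulrBr mulrCA.
have [Eu _] := mulmx1_unit (orthonormal_gram eo); have := Eu.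
rewrite unitmx_mul => /andP[Fu _].
(* The Gram matrix of the difference [d] is zero after congruence by the invertible frame matrix. *)
have d0 : gram x d = 0.
  have := frame_gram e dr dl.
  have -> : \matrix_(i, j) d (e i) (e j) = 0.
    by apply/matrixP => i j; rewrite !mxE /d be eo subrr.
  move=> /(congr1 (mulmx^~ (invmx (frame_mx e)^T))).
  rewrite mulmxK ?unitmx_tr// mul0mx => /(congr1 (mulmx (invmx (frame_mx e)))).
  by rewrite mulKmx// mulmx0.
(* For the two-vector family [v], [w], the off-diagonal entry of the frame Gram matrix is
   [d v w]. *)
have /matrixP/(_ ord0 ord_max) :=
  frame_gram (fun i : 'I_2 => if i == ord0 then v else w) dr dl.
rewrite d0 mulmx0 mul0mx !mxE /= => /esym/eqP.
by rewrite subr_eq0 => /eqP.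
Qed.

End Frames.

(** * Pullbacks of forms are multilinear and alternating *)

Section Pullback.
Variables (R : realType) (k n : nat) (L : omanifold R k) (M : omanifold R n).
Variables (u : L -> M) (x : L).

Lemma differential_linear : linear (differential u x).
Proof. by move=> a v w; rewrite /differential linearP. Qed.

Lemma differential_with m (e : 'I_m -> tangent x) i v :
  (fun j => differential u x ([eta e with i |-> v] j)) =
  [eta (fun j => differential u x (e j)) with i |-> differential u x v]
    :> ('I_m -> tangent (u x)).
Proof. by apply/funext => j /=; case: ifP. Qed.

Variables (m : nat) (alpha : dform M m).

Lemma pullback_multilinear : multilinear_form (pullback_form u alpha x).
Proof.
move=> e i a p q; rewrite /pullback_form !differential_with differential_linear.
exact: dform_multilinear.
Qed.

Lemma pullback_alternating : alternating_form (pullback_form u alpha x).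
Proof.
move=> e i j ij eij; apply: (@dform_alternating _ _ _ _ alpha (u x) _ i j ij).
by rewrite eij.
Qed.

End Pullback.

Theorem theorem3p2 (R : realType) (k n : nat) (k_gt0 : (0 < k)%N)
  (k_le_n : (k <= n)%N)
  (L : omanifold R k) (g : metric L) (M : omanifold R n) (h : metric M)
  (u : L -> M) (u_smooth : smooth_map u)
  (alpha : dform M k) (alpha_calibration : calibration h alpha) :
  let lambda (x : L) : R := (Num.sqrt k%:R)^-1 * diff_norm g h u x in
  (forall x : L,
     covector_le g x (pullback_form u alpha x)
       (fun e => lambda x ^+ k * vol g x e)) /\
  ((forall (x : L) (e : 'I_k -> tangent x),
      pullback_form u alpha x e = lambda x ^+ k * vol g x e) <->
   (forall (x : L) (v w : tangent x),
      pullback_metric u h x v w = lambda x ^+ 2 * g x v w) /\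
   (forall x : L, diff_nonzero_locus u x ->
      calibrated_plane h alpha (image_oriented_bases u x))).
Proof.
move=> lambda.
have lambda_ge0 x : 0 <= lambda x by rewrite mulr_ge0 ?invr_ge0 ?sqrtr_ge0.
have pull_ml x := @pullback_multilinear R k n L M u x k alpha.
have pull_alt x := @pullback_alternating R k n L M u x k alpha.
have alpha_ml x := @dform_multilinear R n M k alpha (u x).
have alpha_alt x := @dform_alternating R n M k alpha (u x).
have du_lin x := @differential_linear R k n L M u x.
have lambdaE x (e : 'I_k -> tangent x) : orthonormal_frame g x e ->
    lambda x = (Num.sqrt k%:R)^-1 * Num.sqrt
      (\sum_i h (u x) (differential u x (e i)) (differential u x (e i))).
  by move=> eo; rewrite /lambda (diff_norm_frame h u eo).
pose i0 := Ordinal k_gt0.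
split=> [x|].
  have [e eo ep] := oriented_orthonormal_exists g x.
  exists (pullback_form u alpha x e), (lambda x ^+ k); split=> //.
    exact: top_form_vol.
  rewrite (lambdaE x e eo).
  by apply: (comass_bound (alpha_ml x) (alpha_alt x)); exact: alpha_calibration.
split=> [pull_eq|[conf cal] x e].
(* On an oriented orthonormal frame [vol] is 1, so the hypothesis is exactly equality in the comass
   bound. *)
- have conf x v w : pullback_metric u h x v w = lambda x ^+ 2 * g x v w.
    have [e eo ep] := oriented_orthonormal_exists g x.
    apply: (bilinear_frame_eq _ _ eo).
    + by move=> p a y z; rewrite /pullback_metric du_lin linearPr.
    + by move=> p a y z; rewrite /pullback_metric du_lin linearPl.
    + rewrite (lambdaE x e eo).
      apply: (comass_bound_eq (alpha_ml x) (alpha_alt x)) => //.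
        exact: alpha_calibration.
      rewrite -(lambdaE x e eo) -[LHS]/(pullback_form u alpha x e) pull_eq.
      by rewrite (vol_frame eo ep) mulr1.
  split=> // x [v dv].
  have l0 : 0 < lambda x.
    rewrite lt_neqAle lambda_ge0 andbT eq_sym; apply/eqP => l0; apply: dv.
    have := conf x v v; rewrite l0 expr0n mul0r => /eqP.
    by rewrite dot_eq0 => /eqP.
  have [e eo ep] := oriented_orthonormal_exists g x.
  (* Conformality scales lengths by [lambda x]; dividing by it makes the image frame orthonormal,
     and being positive it keeps the orientation. *)
  exists (fun i => differential u x ((lambda x)^-1 *: e i)); split.
  + exists (fun i => (lambda x)^-1 *: e i) => //.
    by apply: oriented_basisZ => //; rewrite invr_gt0.
  + move=> i j; rewrite -[LHS]/(pullback_metric u h x _ _) conf.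
    by rewrite dotZ eo mulrA -exprMn divff ?(gt_eqF l0)// expr1n mul1r.
  + rewrite -[LHS]/(pullback_form u alpha x _) (multilinearZ (pull_ml x)).
    rewrite pull_eq (vol_frame eo ep) mulr1 prodr_const card_ord.
    by rewrite -exprMn mulVf ?expr1n// gt_eqF.
(* Where du vanishes, conformality on a unit vector gives [lambda x = 0], and both sides are zero
   because [k] is positive. *)
- have [du_n0|du_0] := pselect (diff_nonzero_locus u x); last first.
    have dv0 v : differential u x v = 0.
      by apply: contrapT => dv; apply: du_0; exists v.
    rewrite /pullback_form (multilinear_at0 (alpha_ml x) (i := i0)) ?dv0//.
    have [e' eo ep] := oriented_orthonormal_exists g x.
    have := conf x (e' i0) (e' i0); rewrite eo eqxx mulr1.
    rewrite /pullback_metric dv0 linear0l => /esym/eqP.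
    rewrite sqrf_eq0 => /eqP ->.
    by rewrite expr0n eqn0Ngt k_gt0 mul0r.
  have [_ [[f fp ->] fo falpha]] := cal x du_n0.
  have lf i j : lambda x ^+ 2 * g x (f i) (f j) = (i == j)%:R.
    by rewrite -conf; exact: fo.
  have l0 : 0 < lambda x.
    rewrite lt_neqAle lambda_ge0 andbT eq_sym; apply/eqP => l0.
    have := lf i0 i0; rewrite l0 expr0n mul0r eqxx => /esym/eqP.
    by rewrite oner_eq0.
  (* By [lf] the rescaled preimages of the calibrated frame are [g]-orthonormal; on them the
     pullback equals [lambda x ^+ k] times the calibrated value 1. *)
  rewrite (@top_form_vol _ _ _ g x _ (fun i => lambda x *: f i)) //.
  + rewrite (multilinearZ (pull_ml x)) prodr_const card_ord.
    by rewrite [pullback_form _ _ _ _]falpha mulr1.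
  + by move=> i j; rewrite dotZ lf.
  + exact: oriented_basisZ.
Qed.
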